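(* Let $(\mathcal{A},\varphi)$ be a $C^*$-probability space such that $\varphi$ is a faithful, tracial state, and let $\mathbb{X},\mathbb{Y}\in\mathcal{A}$ be self-adjoint, free and identically distributed. Assume that the distribution of $\mathbb{X}$ is free Gamma. Then $\mathbb{X}+\mathbb{Y}$ and $(\mathbb{X}+\mathbb{Y})^{-1}\,\mathbb{X}^2\,(\mathbb{X}+\mathbb{Y})^{-1}$ are not free.
   Context: A $C^*$-probability space is a pair $(\mathcal{A},\varphi)$ with $\mathcal{A}$ a unital $C^*$-algebra with unit $\mathbb{I}$ and $\varphi:\mathcal{A}\to\mathbb{C}$ linear with $\varphi(\mathbb{I})=1$ and $\varphi(\mathbb{X}^*\mathbb{X})\ge 0$ for all $\mathbb{X}$. The distribution of a self-adjoint $\mathbb{X}\in\mathcal{A}$ is the probability measure $\mu$ on $\mathbb{R}$ with $\varphi(\mathbb{X}^r)=\int t^r\,\mu(dt)$ for all $r\ge 1$. Freeness: unital subalgebras $\mathcal{A}_1,\dots,\mathcal{A}_n$ of $\mathcal{A}$ are free if $\varphi(\mathbb{X}_1\cdots\mathbb{X}_k)=0$ whenever $\mathbb{X}_j\in\mathcal{A}_{i(j)}$, $\varphi(\mathbb{X}_j)=0$ for all $j$, and $i(1)\neq i(2)\neq\cdots\neq i(k)$. Random variables $\mathbb{X},\mathbb{Y}$ are free if the unital subalgebras generated by $(\mathbb{X},\mathbb{I})$ and by $(\mathbb{Y},\mathbb{I})$ are free. Free Gamma distribution: the law, for some $\lambda>1$ and $\alpha>0$, with density $$\frac{(\lambda-1)\sqrt{\frac{4\lambda}{\alpha^2(\lambda-1)^4}-\left(x-\frac{\lambda+1}{\alpha(\lambda-1)^2}\right)^2}}{2\pi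 x^2}$$ on the interval $\left(\frac{1}{\alpha(1+\sqrt\lambda)^2},\frac{1}{\alpha(1-\sqrt\lambda)^2}\right)$ (and zero elsewhere). This is the law of $\mathbb{Z}^{-1}$ when $\mathbb{Z}$ is free Poisson distributed with parameters $(\lambda,\alpha)$, i.e. has density $\frac{1}{2\pi\alpha x}\sqrt{4\lambda\alpha^2-(x-\alpha(1+\lambda))^2}$ on $(\alpha(1-\sqrt\lambda)^2,\alpha(1+\sqrt\lambda)^2)$. In particular $\mathbb{X}$, $\mathbb{Y}$ and $\mathbb{X}+\mathbb{Y}$ are positive and invertible. *)

(* Defs.v *)
From HB Require Import structures.
From mathcomp Require Import all_boot all_order all_algebra.
From mathcomp Require Import complex.
From mathcomp Require Import all_classical all_reals all_analysis.

Set Implicit Arguments.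
Unset Strict Implicit.
Unset Printing Implicit Defensive.

Import Order.TTheory GRing.Theory Num.Theory.
Import numFieldNormedType.Exports.

Local Open Scope classical_set_scope.
Local Open Scope ring_scope.
Local Open Scope complex_scope.

(* The complete norm is part of the mixin because the hierarchy does not allow
   a join of a normed module with a ring outside of [numDomainType]. The inverse
   [x^-1] is that of the unit algebra, whose axioms make [GRing.unit] the set of
   all two-sided invertible elements; classically, every unital algebra carries
   such a structure. *)
HB.mixin Record isCStarAlgebra (R : realType) A & GRing.UnitAlgebra R[i] A := {
  cnorm : A -> R ;
  cnorm_eq0 : forall x : A, cnorm x = 0 -> x = 0 ;
  cnormD : forall x y : A, cnorm (x + y) <= cnorm x + cnorm y ;
  cnormZ : forall (c : R[i]) (x : A),
    (cnorm (c *: x))%:C = `|c| * (cnorm x)%:C ;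
  cnormM : forall x y : A, cnorm (x * y) <= cnorm x * cnorm y ;
  cnorm_complete : forall u : nat -> A,
    (forall e : R, 0 < e -> exists N : nat, forall m n : nat,
      (N <= m)%N -> (N <= n)%N -> cnorm (u m - u n) < e) ->
    exists l : A, forall e : R, 0 < e -> exists N : nat, forall n : nat,
      (N <= n)%N -> cnorm (u n - l) < e ;
  star : A -> A ;
  starD : forall x y : A, star (x + y) = star x + star y ;
  starZ : forall (c : R[i]) (x : A), star (c *: x) = c^* *: star x ;
  starM : forall x y : A, star (x * y) = star y * star x ;
  starK : forall x : A, star (star x) = x ;
  cnorm_star : forall x : A, cnorm (star x * x) = cnorm x ^+ 2
}.

#[short(type="cstarAlgType")]
HB.structure Definition CStarAlgebra (R : realType) :=
  {A of isCStarAlgebra R A & GRing.UnitAlgebra R[i] A}.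

Section CStarProbability.
Context {R : realType} {A : cstarAlgType R}.
Implicit Types (phi : {scalar A}) (x y : A).

Definition self_adjoint x := star x = x.

Definition is_state phi :=
  phi 1 = 1 /\ forall x, 0 <= phi (star x * x).

Definition faithful_state phi :=
  forall x, phi (star x * x) = 0 -> x = 0.

Definition tracial_state phi :=
  forall x y, phi (x * y) = phi (y * x).

(* For self-adjoint x and a state phi, the moments are bounded by powers of
   [cnorm x], so they determine mu. *)
Definition has_distribution phi x (mu : probability (measurableTypeR R) R) :=
  forall r : nat, (0 < r)%N ->
    mu.-integrable setT (fun t : measurableTypeR R => ((t : R) ^+ r)%:E) /\
    phi (x ^+ r) = (\int[mu]_t ((t : R) ^+ r))%:C.

Definition unital_subalgebra (B : set A) := GRing.subalg_closed (mem B).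

Definition generated_subalgebra x : set A := smallest unital_subalgebra [set x].

(* The product is taken in increasing order of j; words are nonempty. *)
Definition free_subalgebras phi n (B : 'I_n -> set A) :=
  forall (k : nat) (i : 'I_k -> 'I_n) (x : 'I_k -> A),
    (0 < k)%N ->
    (forall j, B (i j) (x j)) ->
    (forall j, phi (x j) = 0) ->
    (forall j j' : 'I_k, j' = j.+1 :> nat -> i j != i j') ->
    phi (\prod_(j < k) x j) = 0.

Definition are_free phi x y :=
  free_subalgebras phi
    (fun i : 'I_2 => generated_subalgebra (if i == ord0 then x else y)).

End CStarProbability.

Section FreeGamma.
Context {R : realType}.
Implicit Types (lambda alpha x : R).

Definition free_gamma_pdf lambda alpha x : R :=
  if (alpha * (1 + Num.sqrt lambda) ^+ 2)^-1 < x
                 < (alpha * (1 - Num.sqrt lambda) ^+ 2)^-1 then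
    (lambda - 1)
    * Num.sqrt (4 * lambda / (alpha ^+ 2 * (lambda - 1) ^+ 4)
                - (x - (lambda + 1) / (alpha * (lambda - 1) ^+ 2)) ^+ 2)
    / (2 * pi * x ^+ 2)
  else 0.

Definition is_free_gamma (mu : probability (measurableTypeR R) R) :=
  exists lambda alpha : R, [/\ 1 < lambda, 0 < alpha &
    forall B : set (measurableTypeR R), measurable B ->
      (mu B = \int[lebesgue_measure]_(x in B)
               (free_gamma_pdf lambda alpha x)%:E)%E].

End FreeGamma.

(* Main.v *)
(* If S = X + Y and W = S^-1 X^2 S^-1 were free, then S W S = X^2 would express
   phi(X^2), phi(X^4) and phi(X^4 S) through phi(W), phi(W^2) and the moments of
   S; eliminating phi(W) and phi(W^2) leaves one polynomial identity between the
   moments of order at most 5 of X, since freeness of X and Y gives the moments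
   of S. With e the mean of the free Gamma law and t its squared coefficient of
   variation, the two sides of this identity differ by
   16 e^11 t^2 (1 + t)^2 (2 + t)^3 <> 0. The same idea disposes of a
   non-invertible S without spectral theory: there MathComp's inverse has
   S^-1 = S, so that W = S X^2 S, and phi(S W) = phi(S) phi(W) already fails. *)
Require Import Defs.
From mathcomp Require Import all_boot all_order all_algebra.
From mathcomp Require Import complex.
From mathcomp Require Import all_classical all_reals all_analysis.
From mathcomp Require Import measurable_realfun ring.

Import Order.TTheory GRing.Theory Num.Theory.
Import numFieldNormedType.Exports.

Local Open Scope classical_set_scope.
Local Open Scope ring_scope.

(** * Mixed moments of two free elements *)

Section Freeness.
Context {R : realType} {A : cstarAlgType R}.
Variable phi : {scalar A}.
Hypothesis phi1 : phi 1 = 1.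

Lemma generated_subalgebra_gen (x : A) : generated_subalgebra x x.
Proof. by apply: sub_gen_smallest. Qed.

Lemma generated_subalgebra_subalg (x : A) :
  unital_subalgebra (generated_subalgebra x).
Proof.
split=> [|c u v|u v] /=.
- by rewrite inE => B [[]]; rewrite /= inE.
- rewrite !inE => xu xv B BP; have [[_ BZ _] _] := BP.
  by have := BZ c u v; rewrite !inE; apply; [exact: xu|exact: xv].
- rewrite !inE => xu xv B BP; have [[_ _ BM] _] := BP.
  by have := BM u v; rewrite !inE; apply; [exact: xu|exact: xv].
Qed.

Lemma generated_subalgebraM (x u v : A) :
  generated_subalgebra x u -> generated_subalgebra x v ->
  generated_subalgebra x (u * v).
Proof.
have [_ _ xM] := generated_subalgebra_subalg x.
by move=> xu xv; have := xM u v; rewrite !inE; apply.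
Qed.

Lemma generated_subalgebraX (x : A) n : generated_subalgebra x (x ^+ n).
Proof.
elim: n => [|n IHn].
  by have [x1 _ _] := generated_subalgebra_subalg x; rewrite inE in x1.
rewrite exprS; apply: generated_subalgebraM => //.
exact: generated_subalgebra_gen.
Qed.

Let center (u : A) := u - (phi u)%:A.

Lemma generated_subalgebra_center (x u : A) :
  generated_subalgebra x u -> generated_subalgebra x (center u).
Proof.
have [x1 xZ _] := generated_subalgebra_subalg x.
move=> xu; have := xZ (- phi u) 1 u; rewrite !inE scaleNr addrC; apply=> //.
by rewrite inE in x1.
Qed.

Lemma phi_center (u : A) : phi (center u) = 0.
Proof. by rewrite /center linearB scalarZ /= phi1 mulr1 subrr. Qed.

(** Two factors are uncentred at a time. The last term keeps [1 * u], so that all four have the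
    shape [phi (_ * u)] and traciality can then bring the factors of [u] to the front for a second
    use. *)
Lemma phi_center2 (a b u : A) : phi (center a * center b * u) =
  phi (a * b * u) - phi a * phi (b * u) - phi b * phi (a * u)
    + phi a * phi b * phi (1 * u).
Proof.
have -> : center a * center b * u = a * b * u - phi b *: (a * u)
    - (phi a *: (b * u) - phi a *: (phi b *: (1 * u))).
  rewrite /center mulrBl !mulrBr !mulrBl -!(scalerAl, scalerAr).
  by rewrite !mul1r !mulr1.
by rewrite !(linearB, scalarZ) /=; ring.
Qed.

Context {x y : A}.
Hypothesis xy_free : are_free phi x y.

Lemma free_moment2 (a b : A) :
  generated_subalgebra x a -> generated_subalgebra y b ->
  phi (a * b) = phi a * phi b.
Proof.
move=> xa yb.
have : phi (center a * center b) = 0.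
  have /= := xy_free 2 id (fun j : 'I_2 => nth 0 [:: center a; center b] j) isT.
  rewrite !big_ord_recl big_ord0 /= mulr1; apply.
  - by case=> [[|[|]]] //= ?; apply: generated_subalgebra_center.
  - by case=> [[|[|]]] //= ?; apply: phi_center.
  - by move=> j j' jj'; rewrite -val_eqE /= jj' neq_ltn ltnSn.
rewrite /center mulrBl !mulrBr -!scalerAl -!scalerAr !mul1r !mulr1.
rewrite !(linearB, scalarZ) /= phi1 => centered0.
apply/eqP; rewrite -subr_eq0; apply/eqP; rewrite -[RHS]centered0; ring.
Qed.

Hypothesis phi_tracial : tracial_state phi.

(** The four centred factors form an alternating word, so [phi] kills their product. Expanding it
    leaves the wanted moment and shorter words, which traciality reduces to products of one element
    from each algebra. *)
Lemma free_moment4 (a b a' b' : A) :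
  generated_subalgebra x a -> generated_subalgebra y b ->
  generated_subalgebra x a' -> generated_subalgebra y b' ->
  phi (a * b * a' * b') = phi (a * a') * phi b * phi b'
    + phi a * phi a' * phi (b * b') - phi a * phi a' * phi b * phi b'.
Proof.
move=> xa yb xa' yb'.
have : phi (center a * center b * center a' * center b') = 0.
  (* Even positions lie in the algebra of [x], odd ones in that of [y]. *)
  have /= := xy_free 4 (fun j : 'I_4 => inord (odd j))
    (fun j => nth 0 [:: center a; center b; center a'; center b'] j) isT.
  rewrite !big_ord_recl big_ord0 /= mulr1 !mulrA; apply.
  - move=> j; rewrite -val_eqE /= inordK; last by case: (odd _).
    by case: j => [[|[|[|[|]]]]] //= ?; apply: generated_subalgebra_center.
  - by case=> [[|[|[|[|]]]]] //= ?; apply: phi_center.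
  - move=> j j' ->; rewrite -val_eqE /= !inordK; by case: (odd _).
(* This is the rotation in which the double use of [phi_center2] produces the leading term. *)
have -> : phi (a * b * a' * b') = phi (a' * b' * (a * b)).
  by rewrite [RHS]phi_tracial mulrA.
rewrite -mulrA phi_center2 !(phi_tracial _ (center a' * _)) !phi_center2.
have -> : phi (b' * (a * b)) = phi a * phi (b * b').
  by rewrite phi_tracial -mulrA free_moment2 //; apply: generated_subalgebraM.
have -> : phi (a' * (a * b)) = phi (a * a') * phi b.
  rewrite mulrA free_moment2 //; last exact: generated_subalgebraM.
  by rewrite (phi_tracial a').
have -> : phi (a' * b' * b) = phi a' * phi (b * b').
  rewrite -mulrA free_moment2 //; last exact: generated_subalgebraM.
  by rewrite (phi_tracial b').
have -> : phi (a' * b' * a) = phi (a * a') * phi b'.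
  by rewrite phi_tracial mulrA free_moment2 //; apply: generated_subalgebraM.
rewrite !mulr1 !mul1r phi1 (phi_tracial b' b) (phi_tracial a' a).
rewrite (phi_tracial b' a) (free_moment2 a b) ?(free_moment2 a b') //.
rewrite (free_moment2 a' b) ?(free_moment2 a' b') // => centered0.
by apply/eqP; rewrite -subr_eq0; apply/eqP; rewrite -[RHS]centered0; ring.
Qed.

(** By freeness the moments of [z] involve [y] only through [phi y] and [phi (y ^+ 2)]. The
    difference on the left is chosen so that [phi (y ^+ 2)] cancels; the factor [phi (x ^+ 2) ^+ 2]
    then turns [phi y ^+ 2] into [phi z ^+ 2]. *)
Lemma free_conj_moments (z := x * y * x) :
  (phi (z ^+ 2) * phi (x ^+ 3) - phi (z ^+ 2 * x) * phi (x ^+ 2))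
    * phi (x ^+ 2) ^+ 2
  = phi z ^+ 2
    * (phi (x ^+ 4) * phi (x ^+ 3) - phi (x ^+ 5) * phi (x ^+ 2)).
Proof.
have xX n := generated_subalgebraX x n; have yy := generated_subalgebra_gen y.
have zE : phi z = phi (x ^+ 2) * phi y.
  by rewrite -free_moment2// /z phi_tracial mulrA.
have z2E : phi (z ^+ 2) = phi (x ^+ 2 * y * x ^+ 2 * y).
  by rewrite /z !expr2 mulrA phi_tracial !mulrA.
have z2xE : phi (z ^+ 2 * x) = phi (x ^+ 3 * y * x ^+ 2 * y).
  have -> : z ^+ 2 * x = x * y * x ^+ 2 * y * x ^+ 2.
    by rewrite /z !expr2 !mulrA.
  by rewrite phi_tracial !mulrA -exprSr.
rewrite z2E z2xE zE !free_moment4// -!exprD -expr2; ring.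
Qed.

End Freeness.

(** * Moments of a sum of two free, identically distributed elements *)

Section FreeSum.
Context {R : realType} {A : cstarAlgType R}.
Variable phi : {scalar A}.
Hypotheses (phi1 : phi 1 = 1) (phi_tracial : tracial_state phi).
Context {X Y : A}.
Hypothesis XY_free : are_free phi X Y.
Hypothesis XY_id : forall n, phi (X ^+ n) = phi (Y ^+ n).

Local Notation m n := (phi (X ^+ n)).
Local Notation S := (X + Y).

Let word2 i j : phi (X ^+ i * Y ^+ j) = m i * m j.
Proof.
rewrite (XY_id j); apply: (free_moment2 phi phi1 XY_free);
  exact: generated_subalgebraX.
Qed.

Let word3 i j k : phi (X ^+ i * Y ^+ j * X ^+ k) = m (k + i) * m j.
Proof. by rewrite phi_tracial mulrA -exprD word2. Qed.

Let word4 i j k l : phi (X ^+ i * Y ^+ j * X ^+ k * Y ^+ l) =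
  m (i + k) * m j * m l + m i * m k * m (j + l) - m i * m k * m j * m l.
Proof.
rewrite (XY_id j) (XY_id l) (XY_id (j + l)) !exprD.
apply: (free_moment4 phi phi1 XY_free phi_tracial);
  exact: generated_subalgebraX.
Qed.

Let word5 i j k l p : phi (X ^+ i * Y ^+ j * X ^+ k * Y ^+ l * X ^+ p) =
  phi (X ^+ (p + i) * Y ^+ j * X ^+ k * Y ^+ l).
Proof. by rewrite phi_tracial !mulrA -exprD. Qed.

(** Six blocks arise only in the expansion of [S ^+ 5], and only with an empty first block, since
    six nonempty ones would need six letters. The outer powers of [Y] then merge cyclically. *)
Let word6 j k l p q :
  phi (X ^+ 0 * Y ^+ j * X ^+ k * Y ^+ l * X ^+ p * Y ^+ q) =
  phi (X ^+ k * Y ^+ l * X ^+ p * Y ^+ (q + j)).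
Proof.
by rewrite [RHS]phi_tracial exprD expr0 mul1r [LHS]phi_tracial !mulrA.
Qed.

(* Peeling off one factor X + Y at a time and merging it into the last block of
   the word keeps every word in the shape X^i Y^j X^k of the lemmas above. *)
Let mulXS (u : A) i n :
  u * X ^+ i * S ^+ n.+1 =
    u * X ^+ i.+1 * S ^+ n + u * X ^+ i * Y ^+ 1 * S ^+ n.
Proof. by rewrite exprS mulrA mulrDr mulrDl exprSr mulrA. Qed.

Let mulYS (u : A) i n :
  u * Y ^+ i * S ^+ n.+1 =
    u * Y ^+ i * X ^+ 1 * S ^+ n + u * Y ^+ i.+1 * S ^+ n.
Proof. by rewrite exprS mulrA mulrDr mulrDl (exprSr Y) mulrA. Qed.

Let mulXS1 i n :
  X ^+ i * S ^+ n.+1 = X ^+ i.+1 * S ^+ n + X ^+ i * Y ^+ 1 * S ^+ n.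
Proof. by rewrite exprS mulrA mulrDr mulrDl exprSr. Qed.

Let mulS0 (u : A) : u * S ^+ 0 = u.
Proof. by rewrite expr0 mulr1. Qed.

Let expand := (mulYS, mulXS, mulXS1, mulS0, raddfD).

Let words := (word6, word5, word4, word3, word2, addSn, add0n).

Lemma free_sum_moment1 : phi S = 2 * m 1.
Proof.
rewrite linearD /= -[X in phi X + _]expr1 -[Y in _ + phi Y]expr1 -XY_id; ring.
Qed.

Lemma free_sum_moment2 : phi (S ^+ 2) = 2 * m 2 + 2 * m 1 ^+ 2.
Proof.
(* The empty block [X ^+ 0] in front gives the rules of [expand] a word to start from. *)
rewrite -[S ^+ 2]mul1r -[1](expr0 X) !expand /= !words expr0.
rewrite phi1; ring.
Qed.

Lemma free_sum_moment3 : phi (S ^+ 3) = 2 * m 3 + 6 * m 2 * m 1.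
Proof.
rewrite -[S ^+ 3]mul1r -[1](expr0 X) !expand /= !words expr0.
rewrite phi1; ring.
Qed.

Lemma free_sum_moment4 : phi (S ^+ 4) =
  2 * m 4 + 8 * m 3 * m 1 + 4 * m 2 ^+ 2 + 4 * m 2 * m 1 ^+ 2 - 2 * m 1 ^+ 4.
Proof.
rewrite -[S ^+ 4]mul1r -[1](expr0 X) !expand /= !words expr0.
rewrite phi1; ring.
Qed.

Lemma free_sum_moment5 : phi (S ^+ 5) =
  2 * m 5 + 10 * m 4 * m 1 + 10 * m 3 * m 2
  + 10 * (m 3 * m 1 ^+ 2 + m 2 ^+ 2 * m 1 - m 2 * m 1 ^+ 3).
Proof.
rewrite -[S ^+ 5]mul1r -[1](expr0 X) !expand /= !words expr0.
rewrite phi1; ring.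
Qed.

(** Needed at [i = 4], when [X + Y] is invertible; the two lemmas that follow serve the other
    case. *)
Lemma free_sum_mixed1 i : phi (X ^+ i * S) = m i.+1 + m i * m 1.
Proof. by rewrite -[S]expr1 !expand /= !words. Qed.

Lemma free_sum_mixed2 i : phi (X ^+ i * S ^+ 2) =
  m i.+2 + 2 * m i.+1 * m 1 + m i * m 2.
Proof. by rewrite !expand /= !words; ring. Qed.

Lemma free_sum_mixed23 : phi (X ^+ 2 * S ^+ 3) =
  m 5 + 3 * m 4 * m 1 + 3 * m 3 * m 2 + m 3 * m 1 ^+ 2 + m 2 ^+ 2 * m 1
  - m 2 * m 1 ^+ 3.
Proof.
rewrite !expand /= !words; ring.
Qed.

End FreeSum.

(** * Integration against a measure with a density *)

Section Density.
Context {R : realType}.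
Notation leb := (@lebesgue_measure R).

(** Having total mass 1, [g] is integrable. It has the same integral as the Radon-Nikodym derivative
    of [nu] over every measurable set, so the two agree almost everywhere and the change of
    variables for that derivative applies. *)
Lemma integral_density (nu : probability (measurableTypeR R) R)
    (g f : R -> R) :
  measurable_fun setT g -> (forall x, 0 <= g x) ->
  (forall B : set (measurableTypeR R), measurable B ->
    nu B = \int[leb]_(x in B) (g x)%:E)%E ->
  nu.-integrable setT (EFin \o f) ->
  (\int[nu]_x (f x)%:E = \int[leb]_x (f x * g x)%:E)%E.
Proof.
move=> mg g0 nuE fi.
have gi : leb.-integrable setT (EFin \o g).
  apply/integrableP; split; first exact/measurable_EFinP.
  under eq_integral do rewrite /= ger0_norm ?g0//.
  by rewrite -nuE// probability_setT ltry.
have numu : nu `<< leb.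
  apply/null_content_dominatesP => B mB B0; rewrite nuE//.
  apply: null_set_integral => //.
  exact/measurable_funTS/measurable_EFinP.
rewrite -(Radon_Nikodym_change_of_variables numu measurableT fi).
under [RHS]eq_integral do rewrite EFinM.
apply: ae_eq_integral => //.
- apply: emeasurable_funM; first exact: measurable_int fi.
  exact: measurable_int (Radon_Nikodym_integrable _).
- apply: emeasurable_funM; first exact: measurable_int fi.
  exact: measurable_int gi.
- apply: ae_eqe_mul2l; apply: integral_ae_eq => //.
  + exact: Radon_Nikodym_integrable.
  + exact: measurable_int gi.
  + move=> E _ mE; rewrite -Radon_Nikodym_integral//.
    by rewrite /= -nuE.
Qed.

End Density.

(** * Weighted moments of the half circle on [[a, b]] *)

Section Semicircle.
Context {R : realType}.
Notation leb := (@lebesgue_measure R).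
Variables (a b : R).
Hypotheses (a0 : 0 < a) (ab : a < b).

(** Since [Num.sqrt] is 0 at negative arguments, this vanishes outside [[a, b]] and is continuous on
    the whole line. *)
Definition half_circle x : R := Num.sqrt ((x - a) * (b - x)).

(* Weighted by x^-2, as is the free Gamma density. *)
Definition half_circle_moment n : R :=
  \int[leb]_(x in `[a, b]) (x ^+ n * (half_circle x / x ^+ 2)).

Lemma continuous_half_circle : continuous half_circle.
Proof.
move=> x; apply: (@continuous_comp _ _ _ (fun x => (x - a) * (b - x)));
  last exact: sqrt_continuous.
by apply: cvgM; apply: cvgB => //; exact: cvg_cst.
Qed.

Lemma continuous_pow_half_circle n (x : R) : x != 0 ->
  {for x, continuous (fun x : R => x ^+ n * (half_circle x / x ^+ 2))}.
Proof.
move=> x0; apply: cvgM; first exact: exprn_continuous.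
apply: cvgM; first exact: continuous_half_circle.
apply: cvgV; first by rewrite expf_neq0.
exact: exprn_continuous.
Qed.

Lemma within_continuous_pow_half_circle n :
  {within `[a, b], continuous (fun x : R => x ^+ n * (half_circle x / x ^+ 2))}.
Proof.
apply: continuous_in_subspaceT => x; rewrite inE /= in_itv /= => /andP[ax _].
by apply: continuous_pow_half_circle; rewrite gt_eqF// (lt_le_trans a0).
Qed.

Lemma integrable_pow_half_circle n :
  leb.-integrable `[a, b]
    (EFin \o (fun x : R => x ^+ n * (half_circle x / x ^+ 2))).
Proof.
apply: continuous_compact_integrable; first exact: segment_compact.
exact: within_continuous_pow_half_circle.
Qed.

Let Q x : R := (x - a) * (b - x).

(* Integrate the derivative of [x^(n-1) Q^(3/2)], which vanishes at a and b. *)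
Lemma half_circle_moment_rec n : (n.+2)%:R * half_circle_moment n.+2 =
  (n%:R + 2^-1) * (a + b) * half_circle_moment n.+1
    - (n%:R - 1) * (a * b) * half_circle_moment n.
Proof.
pose f m x : R := x ^+ m * (half_circle x / x ^+ 2).
pose h x := (n%:R + 2^-1) * (a + b) * f n.+1 x
  - (n%:R - 1) * (a * b) * f n x - (n.+2)%:R * f n.+2 x.
(* The quotient [x ^+ n / x] stands for the power n - 1, which must be -1 and not a truncated 0 when
   n = 0. *)
pose F x : R := x ^+ n / x * (Q x * half_circle x).
have ch m (k : R) : {within `[a, b], continuous (fun x => k * f m x)}.
  move=> x; apply: cvgM; first exact: cvg_cst.
  exact: within_continuous_pow_half_circle.
have dF x : a < x < b -> is_derive x 1 F (h x).
  move=> /andP[ax xb].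
  have x0 : x != 0 by rewrite gt_eqF// (lt_trans a0).
  have Q0 : 0 < Q x by rewrite mulr_gt0 ?subr_gt0.
  have dQ : is_derive x 1 Q (a + b - 2 * x).
    rewrite /Q; apply: is_derive_eq; rewrite /GRing.scale /=; ring.
  have dhc : is_derive x 1 half_circle
      ((a + b - 2 * x) * (2 * half_circle x)^-1).
    have := @is_derive1_comp _ Num.sqrt Q x _ _ (is_derive1_sqrt Q0) dQ.
    by rewrite mulrC.
  have dX : is_derive x 1 (fun x : R => x ^+ n) (n%:R * (x ^+ n / x)).
    have := @is_deriveX R R id n x 1 1 (is_derive_id _ _).
    rewrite exprfctE => dXn.
    apply: is_derive_eq; rewrite /GRing.scale /= mulr1.
    by case: n {ch h f F dXn} => [|n]; rewrite ?mul0r// exprSr mulfK.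
  have dV := @is_deriveV R id x 1 1 x0 (is_derive_id _ _).
  have hc0 : half_circle x != 0 by rewrite gt_eqF// sqrtr_gt0.
  have QE : Q x = half_circle x ^+ 2 by rewrite sqr_sqrtr ?ltW.
  have ? := is_deriveM (is_deriveM dX dV) (is_deriveM dQ dhc).
  apply: is_derive_eq.
  rewrite /GRing.scale /= /h /f !mulrfctE !exprS !expr0.
  (* The half circle in the denominator, from the derivative of the root, cancels against [Q]. *)
  have -> : Q x * ((a + b - 2 * x) / (2 * half_circle x))
      = half_circle x * (a + b - 2 * x) / 2.
    by rewrite QE; field.
  by rewrite /Q -(natr1 n.+1) -(natr1 n); field.
(* The half circle is not differentiable at a and b, but there the fundamental theorem only asks for
   one-sided continuity of [F]. *)
have cF x : x != 0 -> {for x, continuous F}.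
  move=> x0; apply: cvgM.
    by apply: cvgM; [exact: exprn_continuous|exact: cvgV].
  apply: cvgM; last exact: continuous_half_circle.
  by apply: cvgM; apply: cvgB => //; exact: cvg_cst.
have a_neq0 : a != 0 by rewrite gt_eqF.
have b_neq0 : b != 0 by rewrite gt_eqF// (lt_trans a0).
have FTC := @continuous_FTC2 R h F a b ab.
have Fb0 : F b = 0 by rewrite /F /Q subrr mulr0 mul0r mulr0.
have Fa0 : F a = 0 by rewrite /F /Q subrr !mul0r mulr0.
have int0 : \int[leb]_(x in `[a, b]) h x = 0.
  rewrite /Rintegral FTC ?Fa0 ?Fb0 ?subee//.
  - move=> x; apply: cvgB; last exact: ch.
    by apply: cvgB; exact: ch.
  - split.
    + by move=> x; rewrite in_itv /= => /dF [].
    + by apply: cvg_at_right_filter; exact: cF.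
    + by apply: cvg_at_left_filter; exact: cF.
  - by move=> x; rewrite in_itv /= derive1E => /dF [_ ->].
have fi m (k : R) : leb.-integrable `[a, b] (EFin \o (fun x => k * f m x)).
  by apply: continuous_compact_integrable; [exact: segment_compact|exact: ch].
move: int0; rewrite RintegralB//=; first last.
  apply: continuous_compact_integrable; first exact: segment_compact.
  by move=> x; apply: cvgB; exact: ch.
rewrite RintegralB//= !RintegralZl//=; try exact: integrable_pow_half_circle.
by move=> /eqP; rewrite subr_eq0 => /eqP.
Qed.

(* The substitution [x -> ab/x] exchanges the endpoints a and b. *)
Lemma half_circle_moment1 :
  half_circle_moment 1 = Num.sqrt (a * b) * half_circle_moment 0.
Proof.
have b0 : 0 < b by rewrite (lt_trans a0).
have abN0 : a * b != 0 by rewrite mulf_neq0 ?gt_eqF.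
pose F x : R := a * b / x.
have dF (x : R) : 0 < x -> is_derive x 1 F (- (a * b / x ^+ 2)).
  move=> x0.
  have ? := @is_deriveV R id x 1 1 (lt0r_neq0 x0) (is_derive_id _ _).
  apply: is_derive_eq; rewrite /GRing.scale /=; field.
  by rewrite gt_eqF.
have cF (x : R) : 0 < x -> {for x, continuous F}.
  by move=> x0; apply: cvgM; [exact: cvg_cst|apply: cvgV; rewrite ?gt_eqF].
have F'E (x : R) : 0 < x -> derive1 F x = - (a * b / x ^+ 2).
  by move=> x0; rewrite derive1E; have [_ ->] := dF x x0.
have cF' (x : R) : 0 < x -> {for x, continuous (derive1 F)}.
  move=> x0.
  have : (fun x : R => - (a * b / x ^+ 2)) @ x --> derive1 F x.
    rewrite F'E//; apply: cvgN; apply: cvgM; first exact: cvg_cst.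
    by apply: cvgV; rewrite ?expf_neq0 ?gt_eqF//; exact: exprn_continuous.
  apply: cvg_trans; apply: near_eq_cvg.
  by near=> y; rewrite F'E//; near: y; exact: lt_nbhsr.
have Fa : F a = b by rewrite /F mulrAC divff ?mul1r ?gt_eqF.
have Fb : F b = a by rewrite /F mulfK ?gt_eqF.
transitivity (\int[leb]_(x in `[a, b])
    (Num.sqrt (a * b) * (x ^+ 0 * (half_circle x / x ^+ 2)))); last first.
  by rewrite RintegralZl//; exact: integrable_pow_half_circle.
have := @integration_by_substitution_decreasing R F
  (fun x => x ^+ 1 * (half_circle x / x ^+ 2)) a b (ltW ab).
rewrite Fa Fb /half_circle_moment /Rintegral => ->.
- congr fine; apply: eq_integral => x; rewrite inE /= in_itv /= => /andP[ax xb].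
  have x0 : 0 < x by rewrite (lt_le_trans a0).
  congr EFin; rewrite mulrfctE /= opprfctE F'E//.
  (* The radicand at ab/x is ab/x^2 times the radicand at x. *)
  have -> : half_circle (F x) = Num.sqrt (a * b) * x^-1 * half_circle x.
    have xV0 : 0 <= x^-1 by rewrite invr_ge0 ltW.
    rewrite -{1}(ger0_norm xV0) -sqrtr_sqr.
    rewrite -!sqrtrM ?mulr_ge0 ?sqr_ge0 ?(ltW a0) ?(ltW b0)//.
    by congr Num.sqrt; rewrite /F; field; rewrite gt_eqF.
  by rewrite /F; field; rewrite !gt_eqF.
- move=> x y /[!in_itv] /= /andP[ax _] /andP[ay _] xy.
  by rewrite /F ltr_pM2l ?mulr_gt0// ltf_pV2 // posrE (lt_le_trans a0).
- move=> x; rewrite in_itv /= => /andP[ax _].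
  by apply: cF'; rewrite (lt_trans a0).
- by apply/cvgP/cvg_at_right_filter; exact: cF'.
- by apply/cvgP/cvg_at_left_filter; exact: cF'.
- split.
  + move=> x; rewrite in_itv /= => /andP[ax _].
    by have [] := dF x (lt_trans a0 ax).
  + by apply/cvg_at_right_filter; exact: cF.
  + by apply/cvg_at_left_filter; exact: cF.
- exact: within_continuous_pow_half_circle.
Unshelve. all: by end_near.
Qed.

End Semicircle.

(** * The first five moments of the free Gamma law *)

Section FreeGammaMoments.
Context {R : realType}.
Notation leb := (@lebesgue_measure R).

(** The radicand of the density is a quadratic whose roots are the endpoints of the support. *)
Lemma free_gamma_pdfE (lambda alpha : R) : 1 < lambda -> 0 < alpha ->
  exists a b : R, [/\ 0 < a, a < b & free_gamma_pdf lambda alpha =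
    (fun x => (lambda - 1) / (2 * pi) * (half_circle a b x / x ^+ 2))
      \_ `[a, b]].
Proof.
move=> lambda1 alpha0.
pose a := (alpha * (1 + Num.sqrt lambda) ^+ 2)^-1.
pose b := (alpha * (1 - Num.sqrt lambda) ^+ 2)^-1.
have lambda0 : 0 <= lambda by rewrite ltW// (lt_trans ltr01).
(* In terms of [l] the endpoints and the radicand are rational, within reach of [field]. *)
pose l := Num.sqrt lambda.
have lE : lambda = l ^+ 2 by rewrite sqr_sqrtr.
have l1 : 1 < l by rewrite -sqrtr1 ltr_sqrt// (lt_trans ltr01).
have lp : 1 + l != 0 by rewrite gt_eqF// addr_gt0// (lt_trans ltr01).
have lm : 1 - l != 0 by rewrite subr_eq0 lt_eqF.
have ll : l ^+ 2 - 1 != 0.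
  rewrite -[1](expr1n _ 2) subr_sqr mulf_neq0// ?[l + 1]addrC//.
  by rewrite -opprB oppr_eq0.
have l0 : 0 < l by rewrite (lt_trans ltr01).
have lm2 : 0 < (1 - l) ^+ 2.
  by rewrite exprn_even_gt0//= -oppr_eq0 opprB.
have lp2 : (1 - l) ^+ 2 < (1 + l) ^+ 2.
  by rewrite -subr_gt0 (_ : _ - _ = 4 * l) ?mulr_gt0//; ring.
have a0 : 0 < a by rewrite invr_gt0 mulr_gt0// (lt_trans lm2).
have ab : a < b.
  rewrite /a /b -/l ltf_pV2 ?posrE ?(mulr_gt0 alpha0) ?ltr_pM2l//.
  exact: lt_trans lm2 lp2.
exists a, b; split => //; apply/funext => x; rewrite patchE mem_setE in_itv /=.
rewrite /free_gamma_pdf -/a -/b.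
have QE : 4 * lambda / (alpha ^+ 2 * (lambda - 1) ^+ 4)
    - (x - (lambda + 1) / (alpha * (lambda - 1) ^+ 2)) ^+ 2 = (x - a) * (b - x).
  rewrite /a /b -/l lE; field.
  by rewrite lp lm ll gt_eqF.
rewrite QE -/(half_circle a b x).
(* The support is open in the definition and closed here; at both endpoints the half circle is 0. *)
have [->|xa] := eqVneq x a.
  by rewrite ltxx lexx ltW //= /half_circle subrr mul0r sqrtr0 mul0r mulr0.
have [->|xb] := eqVneq x b.
  rewrite ltxx lexx andbF ltW //=.
  by rewrite /half_circle subrr mulr0 sqrtr0 mul0r mulr0.
rewrite !le_eqVlt (eq_sym a) (negPf xa) (negPf xb) /=.
case: ifP => // /andP[ax _].
have x0 : x != 0 by rewrite gt_eqF// (lt_trans a0).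
by move: pi (pi_gt0 R) => p p0; field; rewrite x0 gt_eqF.
Qed.

(** All moments are half-circle moments times the same constant [K], so they obey the same two-step
    recurrence. Total mass 1 and [half_circle_moment1] start it, and no half-circle integral has to
    be evaluated. *)
Lemma free_gamma_moments (mu : probability (measurableTypeR R) R) :
  is_free_gamma mu ->
  (forall r, (0 < r)%N ->
    mu.-integrable setT (fun t : measurableTypeR R => ((t : R) ^+ r)%:E)) ->
  let M r := \int[mu]_t ((t : R) ^+ r) in
  exists e t : R, [/\ 0 < e, 0 < t & [/\ M 1%N = e,
    M 2%N = e ^+ 2 * (1 + t),
    M 3%N = e ^+ 3 * (1 + t) * (1 + 2 * t),
    M 4%N = e ^+ 4 * (1 + t) * (1 + 5 * t + 5 * t ^+ 2) &
    M 5%N = e ^+ 5 * (1 + t) * (1 + 2 * t) * (1 + 7 * t + 7 * t ^+ 2)]].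
Proof.
move=> [lambda [alpha [lambda1 alpha0 muE]]] mu_int M.
have [a [b [a0 ab pdfE]]] := free_gamma_pdfE lambda alpha lambda1 alpha0.
rewrite {}pdfE in muE.
pose K := (lambda - 1) / (2 * pi) : R.
have K0 : 0 <= K by rewrite divr_ge0 ?mulr_ge0 ?pi_ge0 ?subr_ge0 ?ltW.
pose g := (fun x : R => K * (half_circle a b x / x ^+ 2)) \_ `[a, b].
have mg : measurable_fun setT g.
  apply/(measurable_restrictT _ _).1 => //; apply: measurable_funM => //.
  have /measurable_int/measurable_EFinP := integrable_pow_half_circle a b a0 0.
  by apply: eq_measurable_fun => x _; rewrite expr0 mul1r.
have g0 x : 0 <= g x.
  rewrite /g patchE; case: ifP => // _.
  by rewrite mulr_ge0// divr_ge0 ?sqr_ge0 ?sqrtr_ge0.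
have ME r : M r = K * half_circle_moment a b r.
  (* The hypothesis starts at order 1; order 0 is the integral of a constant. *)
  have fi : mu.-integrable setT
      (fun t : measurableTypeR R => ((t : R) ^+ r)%:E).
    case: r => [|r]; last exact: mu_int.
    exact: finite_measure_integrable_cst.
  have /RintegralZl <- // := integrable_pow_half_circle a b a0 r.
  rewrite /M [RHS]Rintegral_mkcond /Rintegral; congr fine.
  have /= -> := integral_density mu _ _ mg g0 muE fi; apply: eq_integral => x _.
  rewrite /g !patchE; case: ifP => _; last by rewrite mulr0.
  by congr EFin; ring.
have M0 : M 0%N = 1.
  rewrite /M; under eq_Rintegral do rewrite expr0.
  by rewrite Rintegral_cst// mul1r /= probability_setT.
have b0 : 0 < b by rewrite (lt_trans a0).
pose e := Num.sqrt (a * b).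
have e0 : 0 < e by rewrite sqrtr_gt0 mulr_gt0.
have eE : a * b = e ^+ 2 by rewrite sqr_sqrtr// mulr_ge0 ?ltW.
(* Chosen so that [a + b = 2 * e * (1 + 2 * t)], which makes the recurrence polynomial in [e] and
   [t]. It is positive by the strict inequality of arithmetic and geometric means for a < b. *)
pose t := (a + b - 2 * e) / (4 * e).
have t0 : 0 < t.
  rewrite divr_gt0 ?mulr_gt0// subr_gt0.
  rewrite -(@ltr_pXn2r _ 2) ?nnegrE ?mulr_ge0 ?addr_ge0 ?ltW//.
  rewrite exprMn -eE -subr_gt0.
  rewrite [ltRHS](_ : _ = (b - a) ^+ 2); last by ring.
  by rewrite exprn_gt0// subr_gt0.
have abE : a + b = 2 * e * (1 + 2 * t) by rewrite /t; field; rewrite gt_eqF.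
have M1 : M 1%N = e.
  by rewrite -[RHS]mulr1 -M0 !ME half_circle_moment1// -/e; ring.
have Mrec n : n.+2%:R * M n.+2 = (n%:R + 2^-1) * (2 * e * (1 + 2 * t)) * M n.+1
    - (n%:R - 1) * e ^+ 2 * M n.
  by rewrite !ME mulrCA half_circle_moment_rec// eE abE; ring.
have M2 : M 2%N = e ^+ 2 * (1 + t).
  by apply: (mulfI (_ : 2%:R != 0 :> R)); rewrite ?pnatr_eq0//
    Mrec M1 M0; field.
have M3 : M 3%N = e ^+ 3 * (1 + t) * (1 + 2 * t).
  by apply: (mulfI (_ : 3%:R != 0 :> R)); rewrite ?pnatr_eq0//
    Mrec M2; field.
have M4 : M 4%N = e ^+ 4 * (1 + t) * (1 + 5 * t + 5 * t ^+ 2).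
  by apply: (mulfI (_ : 4%:R != 0 :> R)); rewrite ?pnatr_eq0//
    Mrec M2 M3; field.
have M5 : M 5%N = e ^+ 5 * (1 + t) * (1 + 2 * t) * (1 + 7 * t + 7 * t ^+ 2).
  by apply: (mulfI (_ : 5%:R != 0 :> R)); rewrite ?pnatr_eq0//
    Mrec M4 M3; field.
by exists e, t.
Qed.

End FreeGammaMoments.

(** * The two polynomial identities that freeness would force *)

Section FreeGammaIdentities.
Context {R : realFieldType}.
Variables (e t x1 x2 x3 x4 x5 : R).
Hypotheses (e0 : 0 < e) (t0 : 0 < t).
Hypotheses (x1E : x1 = e) (x2E : x2 = e ^+ 2 * (1 + t))
 (x3E : x3 = e ^+ 3 * (1 + t) * (1 + 2 * t))
 (x4E : x4 = e ^+ 4 * (1 + t) * (1 + 5 * t + 5 * t ^+ 2))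
 (x5E : x5 = e ^+ 5 * (1 + t) * (1 + 2 * t) * (1 + 7 * t + 7 * t ^+ 2)).
(** With [x1] to [x5] the moments of [X], [m2] to [m5] are those of [X + Y]. *)
Let m2 := 2 * x2 + 2 * x1 ^+ 2.
Let m3 := 2 * x3 + 6 * x2 * x1.
Let m4 := 2 * x4 + 8 * x3 * x1 + 4 * x2 ^+ 2 + 4 * x2 * x1 ^+ 2 - 2 * x1 ^+ 4.
Let m5 := 2 * x5 + 10 * x4 * x1 + 10 * x3 * x2
  + 10 * (x3 * x1 ^+ 2 + x2 ^+ 2 * x1 - x2 * x1 ^+ 3).

(** The premise is [free_conj_moments] for the pair [S], [W], where [z] is [X ^+ 2] and
    [phi (z ^+ 2 * S)] is [x5 + x4 * x1]. *)
Lemma free_gamma_conj_neq :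
  (x4 * m3 - (x5 + x4 * x1) * m2) * m2 ^+ 2 = x2 ^+ 2 * (m4 * m3 - m5 * m2) ->
  False.
Proof.
move=> /eqP; rewrite -subr_eq0 /m2 /m3 /m4 /m5 x5E x4E x3E x2E x1E.
set E := (X in X == 0).
have -> : E = - (16 * e ^+ 11 * t ^+ 2 * (1 + t) ^+ 2 * (2 + t) ^+ 3).
  by rewrite /E; ring.
by apply/negP; rewrite oppr_eq0 gt_eqF// !(mulr_gt0, exprn_gt0, addr_gt0).
Qed.

(** The premise is [phi (S * W) = phi S * phi W] for [W = S * X ^+ 2 * S]. The difference of its
    sides is a product of positive factors. *)
Lemma free_gamma_mixed_neq :
  x5 + 3 * x4 * x1 + 3 * x3 * x2 + x3 * x1 ^+ 2 + x2 ^+ 2 * x1 - x2 * x1 ^+ 3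
  = 2 * x1 * (x4 + 2 * x3 * x1 + x2 ^+ 2) -> False.
Proof.
move=> /eqP; rewrite -subr_eq0 x5E x4E x3E x2E x1E.
set E := (X in X == 0).
have -> : E = 2 * e ^+ 5 * t * (1 + t) * (8 + 16 * t + 7 * t ^+ 2).
  by rewrite /E; ring.
by apply/negP; rewrite gt_eqF// !(mulr_gt0, exprn_gt0, addr_gt0).
Qed.

End FreeGammaIdentities.

Theorem proposition4p3 (R : realType) (A : cstarAlgType R) (phi : {scalar A})
    (phi_state : is_state phi) (phi_faithful : faithful_state phi)
    (phi_tracial : tracial_state phi)
    (X Y : A) (X_sa : self_adjoint X) (Y_sa : self_adjoint Y)
    (XY_free : are_free phi X Y)
    (mu : probability (measurableTypeR R) R)
    (X_mu : has_distribution phi X mu) (Y_mu : has_distribution phi Y mu)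
    (mu_gamma : is_free_gamma mu) :
  ~ are_free phi (X + Y) ((X + Y)^-1 * X ^+ 2 * (X + Y)^-1).
Proof.
have phi1 : phi 1 = 1 := phi_state.1.
have XY_id n : phi (X ^+ n) = phi (Y ^+ n).
  case: n => [|n]; first by rewrite !expr0.
  by have [_ ->] := X_mu n.+1 isT; have [_ ->] := Y_mu n.+1 isT.
have [e [t [e0 t0 [M1 M2 M3 M4 M5]]]] :=
  free_gamma_moments mu mu_gamma (fun r r0 => (X_mu r r0).1).
pose M r := \int[mu]_t ((t : R) ^+ r).
have phiX r : (0 < r)%N -> phi (X ^+ r) = real_complex R (M r).
  by move=> r0; rewrite (X_mu r r0).2.
(* The identities live in [R[i]]; the embedding of [R] is an injective ring morphism, so they
   descend to real ones, where positivity decides. *)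
have toC := (rmorphB (real_complex R), rmorphD, rmorphM, rmorphXn, rmorph_nat).
set S := X + Y; set W := S^-1 * X ^+ 2 * S^-1 => SW_free.
have [S_unit|S_nunit] := boolP (S \is a GRing.unit).
- have SWS : S * W * S = X ^+ 2 by rewrite /W !mulrA divrr// mul1r mulrVK.
  have /= := free_conj_moments phi phi1 SW_free phi_tracial.
  rewrite SWS -exprM (free_sum_moment2 _ phi1 phi_tracial XY_free XY_id).
  rewrite (free_sum_moment3 _ phi1 phi_tracial XY_free XY_id).
  rewrite (free_sum_moment4 _ phi1 phi_tracial XY_free XY_id).
  rewrite (free_sum_moment5 _ phi1 phi_tracial XY_free XY_id).
  rewrite (free_sum_mixed1 _ phi1 XY_free XY_id) !phiX// => eqC.
  apply: (free_gamma_conj_neq e t _ _ _ _ _ e0 t0 M1 M2 M3 M4 M5).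
  by apply: (@complexI R); rewrite !toC.
- have WE : W = S * X ^+ 2 * S by rewrite /W invr_out.
  have := free_moment2 phi phi1 SW_free _ _ (generated_subalgebra_gen S)
    (generated_subalgebra_gen W).
  have -> : phi (S * W) = phi (X ^+ 2 * S ^+ 3).
    (* Traciality gathers the factors [S] on both sides of [X ^+ 2] into one power. *)
    by rewrite WE phi_tracial -!mulrA phi_tracial -!mulrA -expr2 -exprS.
  have -> : phi W = phi (X ^+ 2 * S ^+ 2).
    by rewrite WE -mulrA phi_tracial -mulrA -expr2.
  rewrite (free_sum_mixed23 _ phi1 phi_tracial XY_free XY_id).
  rewrite (free_sum_mixed2 _ phi1 phi_tracial XY_free XY_id).
  rewrite (free_sum_moment1 _ XY_id) !phiX// => eqC.
  apply: (free_gamma_mixed_neq e t _ _ _ _ _ e0 t0 M1 M2 M3 M4 M5).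
  by apply: (@complexI R); rewrite !toC.
Qed.
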